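(* Let $\alpha\in\mathbb C\setminus\{0,-1,-2,\dots\}$ and let $y_n^{(\alpha)}(x)$ be the monic Bessel polynomials. Up to rescaling of $t$, the only generating function of the form $A(t)F(xtA(t)-R(t))$ of the monic Bessel polynomials is the one with $\alpha=3$, $A(t)=(1-t)^{-2}$, $R(t)=0$, $F(t)={}_2F_0\big(\frac32,1;-;2t\big)=\sum_{n\ge0}\big(\frac32\big)_n(2t)^n$, i.e. $$\sum_{n\ge0}\Big(\frac32\Big)_ny_n^{(3)}(x)(2t)^n=(1-t)^{-2}\;{}_2F_0\Big(\tfrac32,1;-;\frac{2xt}{(1-t)^2}\Big)$$ as formal power series in $t$. That is, this identity holds, and if $\{y_n^{(\alpha)}\}$ has a generating function of the form $A(t)F(xtA(t)-R(t))$, then $\alpha=3$ and the generating function is, up to rescaling of $t$, the one with $\alpha_n=2^n\big(\frac32\big)_n$ for $n\ge0$, $A(t)=(1-t)^{-2}$, $R(t)=0$ and $F(t)={}_2F_0\big(\frac32,1;-;2t\big)$.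
   Context: All power series are formal power series with complex coefficients. $(\mu)_0=1$, $(\mu)_n=\mu(\mu+1)\cdots(\mu+n-1)$. ${}_2F_0(a,b;-;z)=\sum_{n\ge0}(a)_n(b)_n\frac{z^n}{n!}$ as a formal power series. A monic polynomial set (MPS) is a sequence $\{P_n(x)\}_{n\ge0}$ with $P_n(x)=x^n+$ lower degree terms. Generating function of the form $A(t)F(xtA(t)-R(t))$ for an MPS $\{P_n\}$: data $\big((\alpha_n)_{n\ge0},A,R,F\big)$ where $\alpha_n\in\mathbb C$, $\alpha_n\ne0$ for all $n$, $\alpha_0=1$, $F(t)=\sum_{n\ge0}\alpha_nt^n$, and $A,R$ are formal power series with $A(0)=1$, $R(0)=0$, such that $$A(t)F(xtA(t)-R(t))=\sum_{n\ge0}\alpha_nP_n(x)t^n$$ as formal power series in $t$ with coefficients in $\mathbb C[x]$. Rescaling of $t$ by $c\in\mathbb C\setminus\{0\}$ is $(\alpha_n,A(t),R(t),F(t))\mapsto(c^n\alpha_n,A(ct),c^{-1}R(ct),F(ct))$, which gives another generating function of the same MPS. The general Bessel polynomials are $y_n^{(\alpha,\beta)}(x)=\sum_{k=0}^n\binom nk(n+\alpha-1)_k\big(\frac x\beta\big)^k$ with $\alpha\notin\{0,-1,-2,\dots\}$, $\beta\neq0$, and the monic Bessel polynomials are $y_n^{(\alpha)}(x)=\dfrac{2^n\,y_n^{(\alpha,1)}(x/2)}{(n+\alpha-1)_n}$. *)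

(* Defs.v *)
From HB Require Import structures.
From mathcomp Require Import all_boot all_order all_algebra.
From mathcomp Require Import boolp reals complex.

Set Implicit Arguments.
Unset Strict Implicit.
Unset Printing Implicit Defensive.

Import GRing.Theory.

Local Open Scope ring_scope.

(* Formal power series K[[t]], as a record so that the Cauchy product does not
   compete with the pointwise ring structure on nat -> K. *)
Record fps (K : Type) : Type := Fps { coefs : nat -> K }.

Lemma fpsP (K : Type) (f g : fps K) :
  (forall n, coefs f n = coefs g n) -> f = g.
Proof. by case: f g => [f] [g] /= fg; congr Fps; apply: funext. Qed.

HB.instance Definition _ (K : Type) := gen_eqMixin (fps K).
HB.instance Definition _ (K : Type) := gen_choiceMixin (fps K).

Section Ring.
Variable K : comNzRingType.
Implicit Types f g h : fps K.

Definition fps_add f g := Fps (fun n => coefs f n + coefs g n).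
Definition fps_opp f := Fps (fun n => - coefs f n).
Definition fpsC (c : K) := Fps (fun n => if n == 0%N then c else 0).
Definition fps_mul f g :=
  Fps (fun n => \sum_(i < n.+1) coefs f i * coefs g (n - i)).

Fact fps_addA : associative fps_add.
Proof. by move=> f g h; apply: fpsP => n /=; rewrite addrA. Qed.
Fact fps_addC : commutative fps_add.
Proof. by move=> f g; apply: fpsP => n /=; rewrite addrC. Qed.
Fact fps_add0 : left_id (fpsC 0) fps_add.
Proof. by move=> f; apply: fpsP => n /=; rewrite if_same add0r. Qed.
Fact fps_addN : left_inverse (fpsC 0) fps_opp fps_add.
Proof. by move=> f; apply: fpsP => n /=; rewrite if_same addNr. Qed.

HB.instance Definition _ :=
  GRing.isZmodule.Build (fps K) fps_addA fps_addC fps_add0 fps_addN.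

Let trunc n f := \poly_(i < n.+1) coefs f i.

Let truncE n f i : (i <= n)%N -> (trunc n f)`_i = coefs f i.
Proof. by move=> le_in; rewrite coef_poly ltnS le_in. Qed.

Let mul_truncE m n f g :
  (n <= m)%N -> coefs (fps_mul f g) n = (trunc m f * trunc m g)`_n.
Proof.
move=> le_nm; rewrite coefM /=; apply: eq_bigr => -[i /= le_in] _.
by rewrite !truncE //; [exact: leq_trans (leq_subr _ _) _ | exact: leq_trans le_nm].
Qed.

Fact fps_mulA : associative fps_mul.
Proof.
move=> f g h; apply: fpsP => n.
rewrite !(@mul_truncE n) //.
transitivity ((trunc n f * (trunc n g * trunc n h))`_n).
  rewrite !coefM; apply: eq_bigr => i _; congr (_ * _).
  by rewrite truncE ?leq_subr // (@mul_truncE n) ?leq_subr.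
rewrite mulrA !coefM; apply: eq_bigr => -[i /= le_in] _.
by congr (_ * _); rewrite truncE // (@mul_truncE n).
Qed.
Fact fps_mulC : commutative fps_mul.
Proof. by move=> f g; apply: fpsP => n; rewrite !(@mul_truncE n) // mulrC. Qed.
Fact fps_mul1 : left_id (fpsC 1) fps_mul.
Proof.
move=> f; apply: fpsP => n /=; rewrite big_ord_recl /= mul1r subn0.
by rewrite big1 ?addr0 // => i _; rewrite mul0r.
Qed.
Fact fps_mulDl : left_distributive fps_mul fps_add.
Proof.
move=> f g h; apply: fpsP => n /=; rewrite -big_split /=.
by apply: eq_bigr => i _; rewrite mulrDl.
Qed.
Fact fps_1neq0 : fpsC 1 != fpsC 0.
Proof.
apply/eqP => /(congr1 (fun f => coefs f 0)) /= /eqP.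
by rewrite oner_eq0.
Qed.

HB.instance Definition _ := GRing.Zmodule_isComNzRing.Build (fps K)
  fps_mulA fps_mulC fps_mul1 fps_mulDl fps_1neq0.

Definition fpsX : fps K := Fps (fun n => (n == 1%N)%:R).

(* f(g(t)); meaningful only when g(0) = 0, in which case the powers g ^+ k with
   k > n do not contribute to the coefficient of t^n. *)
Definition fps_comp f g : fps K :=
  Fps (fun n => \sum_(k < n.+1) coefs f k * coefs (g ^+ k) n).

(* f(ct) *)
Definition fps_scale (c : K) f : fps K := Fps (fun n => c ^+ n * coefs f n).

Lemma coefs0 n : coefs (0 : fps K) n = 0.
Proof. by rewrite /= if_same. Qed.

Lemma coefs1 n : coefs (1 : fps K) n = (n == 0%N)%:R.
Proof. by case: n. Qed.

Lemma coefsD f g n : coefs (f + g) n = coefs f n + coefs g n.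
Proof. by []. Qed.

Lemma coefsN f n : coefs (- f) n = - coefs f n.
Proof. by []. Qed.

Lemma coefsM f g n :
  coefs (f * g) n = \sum_(i < n.+1) coefs f i * coefs g (n - i).
Proof. by []. Qed.

Lemma coefs_sum (I : Type) (r : seq I) (P : pred I) (F : I -> fps K) n :
  coefs (\sum_(i <- r | P i) F i) n = \sum_(i <- r | P i) coefs (F i) n.
Proof.
by apply: (big_morph (fun f => coefs f n)) => [f g|]; rewrite ?coefs0.
Qed.

Lemma coefs_exp_lt g k n : coefs g 0 = 0 -> (n < k)%N -> coefs (g ^+ k) n = 0.
Proof.
move=> g0; elim: k n => // k IHk n lt_nk.
rewrite exprS coefsM big_ord_recl g0 mul0r add0r big1 // => i _.
rewrite IHk ?mulr0 //=; case: i => i /= lt_in.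
by apply: leq_trans (lt_nk : (n <= k)%N); rewrite ltn_subrL (leq_ltn_trans _ lt_in).
Qed.

End Ring.

Section UnitRing.
Variable K : comUnitRingType.
Implicit Types f g : fps K.

Definition fps_unit : pred (fps K) := [pred f | coefs f 0 \is a GRing.unit].

(* 1 / f = u (1 + g + g^2 + ...) with u = f(0)^-1 and g = 1 - u f. *)
Definition fps_inv f : fps K :=
  if f \in fps_unit then
    fpsC (coefs f 0)^-1 *
      fps_comp (Fps (fun=> 1)) (1 - fpsC (coefs f 0)^-1 * f)
  else f.

Lemma fps_geomM g : coefs g 0 = 0 -> fps_comp (Fps (fun=> 1)) g * (1 - g) = 1.
Proof.
move=> g0; apply: fpsP => n.
transitivity (coefs ((\sum_(k < n.+1) g ^+ k) * (1 - g)) n).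
  rewrite !coefsM; apply: eq_bigr => -[i /= le_in] _; congr (_ * _).
  rewrite coefs_sum -!(big_mkord xpredT (fun k => coefs (g ^+ k) i)) /=.
  rewrite (eq_bigr (fun k : 'I_i.+1 => coefs (g ^+ k) i)); last first.
    by move=> k _; rewrite mul1r.
  rewrite [RHS](big_cat_nat (n := i.+1)) //=.
  rewrite [X in _ = _ + X]big_nat [X in _ = _ + X]big1.
    by rewrite addr0 big_mkord.
  by move=> k /andP[lt_ik _]; rewrite coefs_exp_lt.
have -> : (\sum_(k < n.+1) g ^+ k) * (1 - g) = 1 - g ^+ n.+1.
  by rewrite -[RHS]opprB subrX1 -mulNr opprB mulrC.
by rewrite coefsD coefsN (@coefs_exp_lt _ g n.+1 n) // subr0.
Qed.

Fact fps_mulVf : {in fps_unit, left_inverse 1 fps_inv *%R}.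
Proof.
move=> f Uf; rewrite /fps_inv Uf; set u := fpsC _.
have {2}-> : f = fpsC (coefs f 0) * (1 - (1 - u * f)).
  rewrite opprB addrCA subrr addr0 mulrA -[LHS]mul1r; congr (_ * _).
  apply: fpsP => -[|n]; rewrite coefsM.
    by rewrite big_ord1 /= mulrV.
  by rewrite big1 // => -[[|i] /= _] _; rewrite ?mulr0 ?mul0r.
rewrite mulrACA fps_geomM ?mulr1 //=; last by rewrite big_ord1 /= mulVr // subrr.
apply: fpsP => -[|n]; rewrite coefsM.
  by rewrite big_ord1 /= mulVr.
by rewrite big1 // => -[[|i] /= _] _; rewrite ?mulr0 ?mul0r.
Qed.

Fact fps_unitPl f g : g * f = 1 -> fps_unit f.
Proof.
move/(congr1 (fun h => coefs h 0)); rewrite /= big_ord1 /= => gf1.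
by apply/unitrPr; exists (coefs g 0); rewrite mulrC.
Qed.

Fact fps_inv_out : {in [predC fps_unit], fps_inv =1 id}.
Proof. by move=> f; rewrite inE /= /fps_inv => /negbTE ->. Qed.

HB.instance Definition _ := GRing.ComNzRing_hasMulInverse.Build (fps K)
  fps_mulVf fps_unitPl fps_inv_out.

End UnitRing.

(* The embedding of C[[t]] in C[x][[t]]. *)
Definition fps_polyC (K : comNzRingType) (f : fps K) : fps {poly K} :=
  Fps (fun n => (coefs f n)%:P).

Section Sequences.
Variable K : fieldType.

(* The rising factorial (mu)_n. *)
Definition poch (mu : K) (n : nat) : K := \prod_(i < n) (mu + i%:R).

(* 2F0(a, b; -; z) *)
Definition hyp2F0 (a b : K) : fps K :=
  Fps (fun n => poch a n * poch b n / n`!%:R).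

Definition bessel (alpha beta : K) (n : nat) : {poly K} :=
  \sum_(k < n.+1)
    ('C(n, k)%:R * poch (n%:R + alpha - 1) k) *: (beta^-1 *: 'X) ^+ k.

Definition monic_bessel (alpha : K) (n : nat) : {poly K} :=
  (2%:R ^+ n / poch (n%:R + alpha - 1) n) *:
    (bessel alpha 1 n \Po (2%:R^-1 *: 'X)).

Definition monic_polynomial_set (P : nat -> {poly K}) : Prop :=
  forall n, P n \is monic /\ size (P n) = n.+1.

Record gf_data : Type :=
  GFData { gf_alpha : nat -> K; gf_A : fps K; gf_R : fps K; gf_F : fps K }.

(* In C[x][[t]], fpsC 'X is the variable x and fpsX is t. *)
Definition is_generating_function (P : nat -> {poly K}) (G : gf_data) : Prop :=
  let: GFData a A R F := G in
  [/\ monic_polynomial_set P,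
      (forall n, a n != 0) /\ a 0 = 1,
      F = Fps a,
      coefs A 0 = 1 /\ coefs R 0 = 0
    & fps_polyC A *
        fps_comp (fps_polyC F)
          (fpsC 'X * fpsX _ * fps_polyC A - fps_polyC R)
      = Fps (fun n => a n *: P n)].

Definition gf_rescale (c : K) (G : gf_data) : gf_data :=
  let: GFData a A R F := G in
  GFData (fun n => c ^+ n * a n) (fps_scale c A) (fpsC c^-1 * fps_scale c R)
         (fps_scale c F).

Definition bessel_gf : gf_data :=
  GFData (fun n => 2%:R ^+ n * poch (3%:R / 2%:R) n)
         ((1 - fpsX K) ^- 2)
         0
         (fps_scale 2%:R (hyp2F0 (3%:R / 2%:R) 1)).

End Sequences.

(* Main.v *)
From HB Require Import structures.
Require Import Defs.
From mathcomp Require Import all_boot all_order all_algebra.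
From mathcomp Require Import boolp reals complex ring.
Import GRing.Theory Num.Theory.

Set Implicit Arguments.
Unset Strict Implicit.
Unset Printing Implicit Defensive.

Local Open Scope ring_scope.

(** Write S = - R, let a_n be the coefficients of F, A_i and S_i those of A
    and S, and p_(n,k) the coefficient of x^k in the n-th polynomial. Expanding
    (x t A + S)^m by the binomial formula and reading off the coefficient of
    x^k t^(k+j), the functional equation becomes the family of scalar equations
    E(k,j):
      a_(k+j) p_(k+j,k) = sum_(i <= j) a_(k+i) C(k+i,k) [t^j] (A^(k+1) S^i)
    ([gf_coefE], [gf_diag]). Everything follows from this family.

    Existence. For alpha = 3, R = 0 and A = (1 - t)^-2 only i = 0 survives on
    the right, with [t^j] (1-t)^-(2k+2) = C(2k+1+j, j), and both sides of
    E(k,j) are (2k+1+j)! / (2^k k! j!).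

    Uniqueness. Put d = 2k + alpha.
    - E(k,1) reads a_k A_1 d = a_(k+1) (2 - S_1 d); it forces A_1 <> 0 and
      makes every ratio a_k / a_(k+1) an explicit rational function of k.
    - Eliminating the a_n from E(k,2) by these ratios leaves, after clearing
      denominators, a polynomial identity in k. Being valid at all natural
      numbers, it is valid at every scalar. Before clearing denominators the
      only term with a pole at d = -1 is the one that comes from p_(k+2,k),
      so its numerator vanishes there, and this says alpha = 3
      ([gf_bessel_alpha]). The values at d = 0, -2 and 1 then leave two
      possibilities ([gf_bessel_dichotomy]): S_1 = 0, or S_1 = 1 with A_2 and
      S_2 determined by A_1.
    - In the second case a_n = (2n+1) (-A_1)^n. In E(k,3) the unknowns A_3 and
      S_3 occur linearly, and the equations for k = 0, 1, 2 are incompatible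
      ([gf_bessel_S1]).
    - So S_1 = 0, hence a_n = c^n 2^n (3/2)_n with c = A_1 / 2
      ([gf_bessel_coefE]). Finally the a_n determine A and R: the unknowns
      A_j and R_j enter E(0,j) and E(1,j) through a linear system with
      determinant proportional to a_0 a_2 - a_1^2, which is nonzero
      ([gf_unique]). The rescaling by c of the known generating function has
      the same a_n, so it is the given one. *)

(** * Coefficients of formal power series *)

Lemma coefsCM (K : comNzRingType) (c : K) (f : fps K) n :
  coefs (fpsC c * f) n = c * coefs f n.
Proof.
rewrite coefsM big_ord_recl /= subn0 big1 ?addr0 // => i _.
by rewrite mul0r.
Qed.

Lemma coefsCXM (K : comNzRingType) (c : K) k (f : fps K) n :
  coefs (fpsC c ^+ k * f) n = c ^+ k * coefs f n.
Proof.
elim: k f => [|k IHk] f; first by rewrite !expr0 !mul1r.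
by rewrite !exprSr -!mulrA IHk coefsCM.
Qed.

Lemma coefsXM (K : comNzRingType) (f : fps K) n :
  coefs (fpsX K * f) n = if n is m.+1 then coefs f m else 0.
Proof.
case: n => [|n]; first by rewrite coefsM big_ord1 mul0r.
rewrite coefsM big_ord_recl /= mul0r add0r big_ord_recl /= mul1r subSS subn0.
by rewrite big1 ?addr0 // => i _; rewrite mul0r.
Qed.

Lemma coefsXnM (K : comNzRingType) (f : fps K) k n :
  coefs (fpsX K ^+ k * f) n = if (k <= n)%N then coefs f (n - k) else 0.
Proof.
elim: k n => [|k IHk] n; first by rewrite mul1r subn0.
rewrite exprS -mulrA coefsXM; case: n => [|n]; first by [].
by rewrite IHk ltnS subSS.
Qed.

(** Each coefficient of a composition is a finite sum whose length depends on
    the index; since g has no constant term, the longer sums only add zeros,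
    so multiplication by B can be distributed over one common range. *)
Lemma coefs_mul_comp (K : comNzRingType) (B f g : fps K) n : coefs g 0 = 0 ->
  coefs (B * fps_comp f g) n =
  \sum_(m < n.+1) coefs f m * coefs (B * g ^+ m) n.
Proof.
move=> g0.
transitivity (coefs (B * \sum_(m < n.+1) fpsC (coefs f m) * g ^+ m) n).
  rewrite !coefsM; apply: eq_bigr => -[i /= le_in] _; congr (_ * _).
  rewrite coefs_sum.
  under [RHS]eq_bigr do rewrite coefsCM.
  have le_ni : ((n - i).+1 <= n.+1)%N by rewrite ltnS leq_subr.
  rewrite (big_ord_widen _ (fun m => coefs f m * coefs (g ^+ m) (n - i)) le_ni).
  rewrite [RHS](bigID (fun m : 'I_n.+1 => (m < (n - i).+1)%N)) /=.
  rewrite [X in _ = _ + X]big1 ?addr0 // => m; rewrite -leqNgt => lt_m.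
  by rewrite coefs_exp_lt ?mulr0.
rewrite mulr_sumr coefs_sum; apply: eq_bigr => m _.
by rewrite mulrCA coefsCM.
Qed.

Lemma fpsC_nat (K : comNzRingType) m : fpsC m%:R = m%:R :> fps K.
Proof.
elim: m => [|m IHm]; first by rewrite !mulr0n.
by rewrite !mulrS -IHm; apply: fpsP => -[|n] //=; rewrite addr0.
Qed.

(** * Coefficient form of the functional equation *)

Section PolyC.
Variable K : comNzRingType.
Implicit Types f g : fps K.

Fact fps_polyC_zmod : zmod_morphism (@fps_polyC K).
Proof. by move=> f g; apply: fpsP => n /=; rewrite polyCB. Qed.

Fact fps_polyC_monoid : monoid_morphism (@fps_polyC K).
Proof.
split=> [|f g]; apply: fpsP => n /=; first by case: eqP.
by rewrite rmorph_sum; apply: eq_bigr => i _; rewrite rmorphM.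
Qed.

HB.instance Definition _ := GRing.isZmodMorphism.Build
  (fps K) (fps {poly K}) (@fps_polyC K) fps_polyC_zmod.
HB.instance Definition _ := GRing.isMonoidMorphism.Build
  (fps K) (fps {poly K}) (@fps_polyC K) fps_polyC_monoid.

Lemma fps_polyC_X : fps_polyC (fpsX K) = fpsX {poly K}.
Proof. by apply: fpsP => n /=; case: eqP. Qed.

Fact fps_scale_zmod (c : K) : zmod_morphism (fps_scale c).
Proof. by move=> f g; apply: fpsP => n /=; rewrite mulrDr mulrN. Qed.

Fact fps_scale_monoid (c : K) : monoid_morphism (fps_scale c).
Proof.
split=> [|f g]; apply: fpsP => n /=.
  by case: n => [|n]; rewrite ?mul1r ?mulr0.
rewrite mulr_sumr; apply: eq_bigr => -[i /= le_in] _.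
by rewrite -{1}(subnKC (le_in : (i <= n)%N)) exprD mulrACA.
Qed.

HB.instance Definition _ (c : K) := GRing.isZmodMorphism.Build
  (fps K) (fps K) (fps_scale c) (fps_scale_zmod c).
HB.instance Definition _ (c : K) := GRing.isMonoidMorphism.Build
  (fps K) (fps K) (fps_scale c) (fps_scale_monoid c).

Lemma fps_scale_X (c : K) : fps_scale c (fpsX K) = fpsC c * fpsX K.
Proof.
apply: fpsP => n; rewrite coefsCM /=.
by case: n => [|[|n]]; rewrite ?mulr0 ?expr1.
Qed.

Lemma fps_comp_scale (c : K) f g :
  fps_comp (fps_scale c f) g = fps_comp f (fpsC c * g).
Proof.
apply: fpsP => n /=; apply: eq_bigr => m _.
by rewrite exprMn_comm ?coefsCXM 1?[c ^+ m * _]mulrC ?mulrA //; apply: mulrC.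
Qed.

(** Only the summand of index k in the binomial expansion of
    (- R + x (t A))^m contains x^k. The statement holds for k > m as well,
    because the binomial coefficient is then 0; the value of the truncated
    difference m - k is irrelevant in that case. *)
Lemma coef_gf_term (A R : fps K) m k n :
  (coefs (fps_polyC A *
     (fpsC 'X * fpsX _ * fps_polyC A - fps_polyC R) ^+ m) n)`_k =
  'C(m, k)%:R * coefs (fpsX K ^+ k * (A ^+ k.+1 * (- R) ^+ (m - k))) n.
Proof.
have -> : fpsC 'X * fpsX _ * fps_polyC A - fps_polyC R =
    fps_polyC (- R) + fpsC 'X * fps_polyC (fpsX K * A).
  by rewrite rmorphM rmorphN /= fps_polyC_X addrC mulrA.
rewrite exprDn mulr_sumr coefs_sum coef_sum.
have term (i : 'I_m.+1) :
    (coefs (fps_polyC A * (fps_polyC (- R) ^+ (m - i) *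
       (fpsC 'X * fps_polyC (fpsX K * A)) ^+ i *+ 'C(m, i))) n)`_k =
    if k == i then
      'C(m, k)%:R * coefs (fpsX K ^+ k * (A ^+ k.+1 * (- R) ^+ (m - k))) n
    else 0.
  have -> : fps_polyC A * (fps_polyC (- R) ^+ (m - i) *
       (fpsC 'X * fps_polyC (fpsX K * A)) ^+ i *+ 'C(m, i)) =
      fpsC 'C(m, i)%:R * (fpsC 'X ^+ i *
        fps_polyC (fpsX K ^+ i * (A ^+ i.+1 * (- R) ^+ (m - i)))).
    rewrite -mulr_natl -fpsC_nat exprMn.
    rewrite exprS !rmorphM !rmorphXn exprMn /=; ring.
  rewrite coefsCM coefsCXM -polyC_natr coefCM coefXnM coefC.
  case: ltngtP => [lt_ki|lt_ik|<-]; rewrite ?mulr0 //.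
    by rewrite subn_eq0 leqNgt lt_ik mulr0.
  by rewrite subnn eqxx.
rewrite (eq_bigr _ (fun i _ => term i)) -big_mkcond /=.
have [lt_km | lt_mk] := ltnP k m.+1.
  by rewrite (big_pred1 (Ordinal lt_km)) // => i; rewrite eq_sym.
rewrite bin_small // mul0r big_pred0 // => i.
by apply/eqP => ki; move: (ltn_ord i); rewrite -ki ltnNge lt_mk.
Qed.

End PolyC.

(** An equivalence, since it serves both to verify a generating function and to
    extract necessary conditions from one. *)
Lemma gf_coefE (K : comNzRingType) (P : nat -> {poly K}) (a : nat -> K)
    (A R : fps K) : coefs R 0 = 0 ->
  (fps_polyC A * fps_comp (fps_polyC (Fps a))
     (fpsC 'X * fpsX _ * fps_polyC A - fps_polyC R) = Fps (fun n => a n *: P n))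
  <-> (forall n k, a n * (P n)`_k = \sum_(m < n.+1) a m * ('C(m, k)%:R *
         coefs (fpsX K ^+ k * (A ^+ k.+1 * (- R) ^+ (m - k))) n)).
Proof.
move=> R0; set S := _ - _; have S0 : coefs S 0 = 0.
  by rewrite coefsD coefsN -mulrA coefsCM coefsXM mulr0 /= R0 subr0.
have coefE n k : (coefs (fps_polyC A * fps_comp (fps_polyC (Fps a)) S) n)`_k =
    \sum_(m < n.+1) a m * ('C(m, k)%:R *
      coefs (fpsX K ^+ k * (A ^+ k.+1 * (- R) ^+ (m - k))) n).
  rewrite coefs_mul_comp // coef_sum; apply: eq_bigr => m _.
  by rewrite /= coefCM coef_gf_term.
split=> [eqP n k|eqP]; first by rewrite -coefE eqP /= coefZ.
by apply: fpsP => n; apply/polyP => k; rewrite coefE /= coefZ.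
Qed.

(** The factor t^k makes the terms m < k vanish, so only j = n - k and
    i = m - k matter: these are the equations E(k,j). *)
Lemma gf_diag (K : comNzRingType) (P : nat -> {poly K}) (a : nat -> K)
    (A R : fps K) : coefs R 0 = 0 ->
  fps_polyC A * fps_comp (fps_polyC (Fps a))
     (fpsC 'X * fpsX _ * fps_polyC A - fps_polyC R) = Fps (fun n => a n *: P n) ->
  forall k j, a (k + j)%N * (P (k + j)%N)`_k =
    \sum_(i < j.+1) a (k + i)%N *
      ('C(k + i, k)%:R * coefs (A ^+ k.+1 * (- R) ^+ i) j).
Proof.
move=> R0 /gf_coefE -/(_ R0) gfE k j; rewrite gfE.
rewrite -(big_mkord xpredT (fun m => a m * ('C(m, k)%:R *
      coefs (fpsX K ^+ k * (A ^+ k.+1 * (- R) ^+ (m - k))) (k + j)))).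
rewrite (big_cat_nat (n := k)) //; last by rewrite leqW // leq_addr.
rewrite big_nat big1 ?Monoid.mul1m => [|m /andP[_ lt_mk]]; last first.
  by rewrite bin_small // mul0r mulr0.
rewrite -[X in index_iota X]add0n -addnS big_addn addKn big_mkord.
apply: eq_bigr => i _; rewrite coefsXnM leq_addr addKn.
by rewrite [(i + k)%N]addnC addKn.
Qed.

(** * Rescaling of t *)

Lemma coefs_scale (K : comNzRingType) (c : K) (f : fps K) n :
  coefs (fps_scale c f) n = c ^+ n * coefs f n.
Proof. by []. Qed.

(** In the coefficient of x^k t^n the m-th term acquires c^m from alpha_m,
    c^(n-k) from the substitution t := c t in A^(k+1) (-R)^(m-k), and
    c^-(m-k) from the factor c^-1 of R: altogether c^n. *)
Lemma is_gf_rescale (K : fieldType) (c : K) P G : c != 0 ->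
  is_generating_function P G -> is_generating_function P (gf_rescale c G).
Proof.
move=> nz_c; case: G => a A R F [monP [nz_a a0] defF [A0 R0] gfE].
have {gfE}gfE : forall n k, a n * (P n)`_k = \sum_(m < n.+1) a m *
    ('C(m, k)%:R * coefs (fpsX K ^+ k * (A ^+ k.+1 * (- R) ^+ (m - k))) n).
  by apply/gf_coefE; rewrite // -defF.
have sF : fps_scale c F = Fps (fun n => c ^+ n * a n) by rewrite defF.
have sR0 : coefs (fpsC c^-1 * fps_scale c R) 0 = 0.
  by rewrite coefsCM /= R0 !mulr0.
split=> //; first by split=> [n|]; rewrite ?mul1r // mulf_neq0 ?expf_neq0.
  by split; rewrite //= A0 mul1r.
rewrite sF; apply/gf_coefE => // n k.
rewrite -mulrA gfE mulr_sumr; apply: eq_bigr => i _.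
move: (nat_of_ord i) => m {i}.
have [lt_mk | le_km] := ltnP m k; first by rewrite bin_small // !mul0r !mulr0.
have -> : fpsX K ^+ k * (fps_scale c A ^+ k.+1 *
      (- (fpsC c^-1 * fps_scale c R)) ^+ (m - k)) =
    fpsC c^-1 ^+ k * (fpsC c^-1 ^+ (m - k) *
      fps_scale c (fpsX K ^+ k * (A ^+ k.+1 * (- R) ^+ (m - k)))).
  rewrite !rmorphM !rmorphXn rmorphN /= fps_scale_X.
  have uv1 : fpsC c^-1 ^+ k * fpsC c ^+ k = 1 :> fps K.
    rewrite -exprMn -[RHS](expr1n _ k); congr (_ ^+ k); apply: fpsP => l.
    by rewrite coefsCM; case: l => [|l] /=; rewrite ?mulr0 ?mulVf.
  rewrite -mulrN exprMn [(fpsC c * _) ^+ k]exprMn.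
  by rewrite -[LHS]mul1r -uv1; ring.
rewrite !coefsCXM coefs_scale !exprVn.
rewrite -[in c ^+ m](subnKC le_km) exprD.
by field; rewrite !expf_neq0.
Qed.

(** * Coefficients of the monic Bessel polynomials *)

Lemma pochS (K : fieldType) (x : K) n : poch x n.+1 = poch x n * (x + n%:R).
Proof. by rewrite /poch big_ord_recr. Qed.

Lemma pochD (K : fieldType) (x : K) m n :
  poch x (m + n)%N = poch x m * poch (x + m%:R) n.
Proof.
elim: n => [|n IHn]; first by rewrite addn0 /poch big_ord0 mulr1.
by rewrite addnS !pochS IHn natrD !mulrA addrA.
Qed.

Lemma poch_nat (K : fieldType) (N m : nat) :
  poch N.+1%:R m * N`!%:R = (N + m)`!%:R :> K.
Proof.
elim: m => [|m IHm]; first by rewrite /poch big_ord0 mul1r addn0.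
by rewrite pochS mulrAC IHm -natrD -natrM mulnC addSn addnS factS.
Qed.

Lemma coef_monic_bessel (K : numFieldType) (alpha : K) n k :
  (monic_bessel alpha n)`_k = if (k <= n)%N then
    2%:R ^+ (n - k) * 'C(n, k)%:R * poch (n%:R + alpha - 1) k
      / poch (n%:R + alpha - 1) n
  else 0.
Proof.
rewrite /monic_bessel coefZ.
have -> : bessel alpha 1 n \Po (2%:R^-1 *: 'X) = \poly_(i < n.+1)
    ('C(n, i)%:R * poch (n%:R + alpha - 1) i * 2%:R ^- i).
  rewrite poly_def /bessel linear_sum; apply: eq_bigr => i _ /=.
  rewrite linearZ /= invr1 scale1r rmorphXn /= comp_polyX exprZn exprVn.
  by rewrite scalerA.
rewrite coef_poly ltnS; case: leqP => [le_kn|_]; last by rewrite mulr0.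
rewrite -{1}(subnK le_kn) exprD.
move: (poch _ k) (poch _ n)^-1 => x y.
by field; rewrite expf_neq0 // pnatr_eq0.
Qed.

(** The factors of this product are alpha + i with n - 1 <= i <= 2n - 2. *)
Lemma poch_bessel_neq0 (K : numFieldType) (alpha : K) n :
  (forall k : nat, alpha <> - k%:R) -> poch (n%:R + alpha - 1) n != 0.
Proof.
move=> halpha; apply/prodf_neq0 => -[i /= lt_in] _; apply/eqP => eq0.
case: n lt_in eq0 => // n lt_in eq0; apply: (halpha (n + i)%N).
by apply/eqP; rewrite -subr_eq0 opprK natrD -eq0 mulrS; apply/eqP; ring.
Qed.

Lemma monic_bessel_monic (K : numFieldType) (alpha : K) :
  (forall k : nat, alpha <> - k%:R) -> monic_polynomial_set (monic_bessel alpha).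
Proof.
move=> halpha n.
have lead : (monic_bessel alpha n)`_n = 1.
  rewrite coef_monic_bessel leqnn subnn binn !mul1r mulfV //.
  exact: poch_bessel_neq0.
have size_le : (size (monic_bessel alpha n) <= n.+1)%N.
  by apply/leq_sizeP => k lt_nk; rewrite coef_monic_bessel leqNgt lt_nk.
have size_eq : size (monic_bessel alpha n) = n.+1.
  apply/eqP; rewrite eqn_leq size_le ltnNge; apply/negP => /leq_sizeP/(_ n).
  by rewrite lead leqnn => /(_ isT)/eqP; rewrite oner_eq0.
by split=> //; rewrite monicE lead_coefE size_eq lead.
Qed.

(** * The generating function of the polynomials with parameter 3 *)

Lemma unit_1subX (K : comUnitRingType) : (1 - fpsX K) \is a GRing.unit.
Proof.
by change (1 - 0 \is a @GRing.unit K); rewrite subr0 unitr1.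
Qed.

(** By induction on p: multiplying by 1 - t takes differences of consecutive
    coefficients, and Pascal's rule says that these are the coefficients of
    the previous power. *)
Lemma coefs_geomX (K : comUnitRingType) p j :
  coefs ((1 - fpsX K) ^- p.+1) j = 'C(p + j, p)%:R.
Proof.
suff -> : (1 - fpsX K) ^- p.+1 = Fps (fun j => 'C(p + j, p)%:R) by [].
have step q (f : fps K) : (1 - fpsX K) * f = (1 - fpsX K) ^- q ->
    (1 - fpsX K) ^- q.+1 = f.
  move=> /(congr1 ( *%R (1 - fpsX K)^-1)); rewrite mulKr ?unit_1subX // => ->.
  by rewrite exprS invrM ?unitrX ?unit_1subX // mulrC.
elim: p => [|p IHp]; apply: step.
  apply: fpsP => -[|n]; rewrite mulrBl mul1r coefsD coefsN coefsXM /=.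
    by rewrite subr0 invr1.
  by rewrite !bin0 subrr expr0 invr1.
rewrite IHp; apply: fpsP => -[|n]; rewrite mulrBl mul1r coefsD coefsN coefsXM /=.
  by rewrite subr0 !addn0 !binn.
by rewrite !addSn !addnS binS natrD addrC addKr.
Qed.

(** 2^n (3/2)_n is the product 3 * 5 * ... * (2n+1), and 2^n n! is the product
    of the even numbers up to 2n. *)
Lemma poch_three_halves (K : numFieldType) n :
  2%:R ^+ n * poch (3%:R / 2%:R) n * (2%:R ^+ n * n`!%:R) = (n.*2.+1)`!%:R :> K.
Proof.
elim: n => [|n IHn]; first by rewrite /poch big_ord0 !mul1r.
have -> : (n.+1.*2.+1)`! = (n.*2.+3 * (n.*2.+2 * n.*2.+1`!))%N by [].
rewrite (natrM _ n.*2.+3) (natrM _ n.*2.+2) -IHn pochS.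
by rewrite factS (natrM _ n.+1) !exprS -muln2; field.
Qed.

(** With R = 0 only the term m = k survives in the coefficient of x^k t^n, and
    the claim reduces to an identity between quotients of factorials. *)
Lemma monic_bessel3_gf (K : numFieldType) :
  is_generating_function (monic_bessel (3%:R : K)) (bessel_gf K).
Proof.
have nzn n : (n.+1%:R : K) != 0 by rewrite pnatr_eq0.
have nzf n : (n`!%:R : K) != 0 by rewrite pnatr_eq0 -lt0n fact_gt0.
have nz2 n : (2%:R ^+ n : K) != 0 by rewrite expf_neq0.
have hF : fps_scale 2%:R (hyp2F0 (3%:R / 2%:R : K) 1) =
    Fps (fun n => 2%:R ^+ n * poch (3%:R / 2%:R) n).
  apply: fpsP => n /=; congr (_ * _).
  by have := poch_nat K 0 n; rewrite mulr1 add0n => ->; rewrite mulfK.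
split=> //.
- apply: monic_bessel_monic => k /eqP; rewrite -subr_eq0 opprK -natrD.
  by rewrite addSn (negPf (nzn _)).
- split=> [n|]; last by rewrite /poch big_ord0 mulr1.
  rewrite mulf_neq0 //; apply/prodf_neq0 => i _.
  have -> : 3%:R / 2%:R + i%:R = (3 + i.*2)%:R / 2%:R :> K.
    by rewrite natrD -muln2 natrM; field.
  by rewrite mulf_neq0 ?invr_eq0 ?pnatr_eq0.
- by rewrite coefs0 (coefs_geomX _ 1).
rewrite hF; apply/gf_coefE => [|n k]; first by rewrite coefs0.
rewrite oppr0 coef_monic_bessel.
have [le_kn|lt_nk] := leqP k n; last first.
  rewrite mulr0 big1 // => -[m /= lt_mn] _.
  by rewrite bin_small ?mul0r ?mulr0 // (leq_trans lt_mn).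
rewrite (bigD1 (Ordinal (le_kn : (k < n.+1)%N))) // [X in _ = _ + X]big1; last first.
  move=> m /eqP neq_mk; have [lt_mk | le_km] := ltnP m k.
    by rewrite bin_small // mul0r mulr0.
  rewrite expr0n subn_eq0 leqNgt ltn_neqAle le_km andbT.
  have -> : k != m :> nat by apply/eqP=> km; apply: neq_mk; apply: val_inj.
  by rewrite !mulr0 coefs0 !mulr0.
rewrite addr0 [nat_of_ord _]/= subnn expr0 binn mul1r mulr1.
rewrite [coefs _ _ in RHS]coefsXnM le_kn.
rewrite exprVn -exprM [(2 * _)%N]mulnC muln2 doubleS coefs_geomX.
have -> : n%:R + 3%:R - 1 = n.+2%:R :> K by rewrite -addn2 natrD; ring.
have poch_fr m : poch n.+2%:R m = (n.+1 + m)`!%:R / n.+1`!%:R :> K.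
  by rewrite -poch_nat mulfK.
have p32 m : 2%:R ^+ m * poch (3%:R / 2%:R) m =
    m.*2.+1`!%:R / (2%:R ^+ m * m`!%:R) :> K.
  by rewrite -poch_three_halves mulfK ?mulf_neq0.
have bin_fr m i : 'C(m + i, m)%:R = (m + i)`!%:R / (m`!%:R * i`!%:R) :> K.
  rewrite -(bin_fact (leq_addr i m)) addKn !natrM.
  by rewrite mulfK ?mulf_neq0.
rewrite !p32 !poch_fr -(subnKC le_kn); move: (n - k)%N => j; rewrite addKn !bin_fr.
have -> : ((k + j).+1 + (k + j))%N = (k + j).*2.+1 by rewrite addSn addnn.
have -> : ((k + j).+1 + k)%N = (k.*2.+1 + j)%N.
  by rewrite -addnn !addSn -!addnA [(j + k)%N]addnC.
by rewrite exprD; field; rewrite !nzf !nz2.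
Qed.

Lemma monic_bessel3_series (K : numFieldType) :
  Fps (fun n => (poch (3%:R / 2%:R) n * 2%:R ^+ n) *: monic_bessel (3%:R : K) n)
  = (1 - fpsX {poly K}) ^- 2 *
      fps_comp (fps_polyC (hyp2F0 (3%:R / 2%:R) 1))
        (2%:R * fpsC 'X * fpsX {poly K} / (1 - fpsX {poly K}) ^+ 2).
Proof.
have [_ _ _ _] := monic_bessel3_gf K.
rewrite (rmorphV _ (unitrX 2 (unit_1subX K))) rmorphXn rmorphB rmorph1 /=.
rewrite fps_polyC_X rmorph0 subr0.
have -> : fps_polyC (fps_scale 2%:R (hyp2F0 (3%:R / 2%:R : K) 1)) =
    fps_scale 2%:R (fps_polyC (hyp2F0 (3%:R / 2%:R) 1)).
  by apply: fpsP => n /=; rewrite polyCM rmorphXn rmorph_nat.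
rewrite fps_comp_scale fpsC_nat !mulrA => ->.
by apply: fpsP => n /=; rewrite [X in X *: _]mulrC.
Qed.

(** * A generating function is determined by the coefficients of F *)

Lemma coefsM0 (K : comNzRingType) (f g : fps K) :
  coefs (f * g) 0 = coefs f 0 * coefs g 0.
Proof. by rewrite coefsM big_ord1. Qed.

Lemma coefs_exp0 (K : comNzRingType) (f : fps K) n :
  coefs (f ^+ n) 0 = coefs f 0 ^+ n.
Proof. by elim: n => [|n IHn]; rewrite ?coefs1 // !exprS coefsM0 IHn. Qed.

Lemma coefsM_low (K : comNzRingType) (f g : fps K) j :
  (forall i, (i < j)%N -> coefs f i = 0) ->
  coefs (f * g) j = coefs f j * coefs g 0.
Proof.
move=> low; rewrite coefsM big_ord_recr /= subnn big1 ?add0r // => i _.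
by rewrite low ?mul0r.
Qed.

(** First-order variation: if A and S are modified only from order j on, the
    coefficient of t^j in A^p S^i moves linearly. Because A(0) = 1 and
    S(0) = 0, it feels the change of A only when i = 0 and the change of S
    only when i = 1. *)
Lemma coefs_sub_expM_low (K : comNzRingType) (A A' S S' : fps K) p i j :
    coefs A 0 = 1 -> coefs A' 0 = 1 -> coefs S 0 = 0 -> coefs S' 0 = 0 ->
    (forall l, (l < j)%N -> coefs (A - A') l = 0) ->
    (forall l, (l < j)%N -> coefs (S - S') l = 0) ->
  coefs (A ^+ p * S ^+ i) j - coefs (A' ^+ p * S' ^+ i) j =
  (i == 0)%:R * p%:R * coefs (A - A') j + (i == 1)%:R * coefs (S - S') j.
Proof.
move=> A0 A'0 S0 S'0 lowA lowS; rewrite -coefsN -coefsD.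
have -> : A ^+ p * S ^+ i - A' ^+ p * S' ^+ i =
    (A - A') * ((\sum_(l < p) A ^+ (p.-1 - l) * A' ^+ l) * S ^+ i) +
    (S - S') * (A' ^+ p * \sum_(l < i) S ^+ (i.-1 - l) * S' ^+ l).
  by rewrite [in RHS]mulrA mulrCA -!subrXX; ring.
rewrite [in LHS]coefsD (coefsM_low _ lowA) (coefsM_low _ lowS) !coefsM0.
rewrite !coefs_exp0 S0 A'0 expr1n mul1r.
rewrite !coefs_sum (eq_bigr (fun=> 1)); last first.
  by move=> l _; rewrite coefsM0 !coefs_exp0 A0 A'0 !expr1n mulr1.
rewrite sumr_const card_ord; congr (_ + _).
  by case: i => [|i]; rewrite ?expr0n /=; ring.
rewrite mulrC; congr (_ * _); case: i => [|[|i]].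
- by rewrite big_ord0.
- by rewrite big_ord1 mulr1.
- rewrite big1 // => -[[|l] lt_l] _; rewrite coefsM0 !coefs_exp0 S0 S'0 /=.
    by rewrite subn0 expr0n mul0r.
  by rewrite [0 ^+ l.+1]expr0n mulr0.
Qed.

(** By induction on j: if A, A' and R, R' agree below order j, subtracting the
    equations E(k,j) of the two data leaves
      a_k (A_j - A'_j) = a_(k+1) (R_j - R'_j),
    and the cases k = 0, 1 form a linear system with determinant
    a_0 a_2 - a_1^2, up to sign. *)
Lemma gf_unique (K : numFieldType) (P : nat -> {poly K}) (G G' : gf_data K) :
  is_generating_function P G -> is_generating_function P G' ->
  gf_alpha G = gf_alpha G' ->
  gf_alpha G 0 * gf_alpha G 2 != gf_alpha G 1 ^+ 2 -> G = G'.
Proof.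
case: G G' => a A R F [a' A' R' F'] [_ _ -> [A0 R0] gfE] [_ _ -> [A'0 R'0] gfE'].
move=> /= eq_a nz_det; move: gfE'; rewrite -{a'}eq_a => gfE'.
have S0 : coefs (- R) 0 = 0 by rewrite coefsN R0 oppr0.
have S'0 : coefs (- R') 0 = 0 by rewrite coefsN R'0 oppr0.
have diag := gf_diag R0 gfE; have diag' := gf_diag R'0 gfE'.
suff sub0 j : coefs (A - A') j = 0 /\ coefs (- R - - R') j = 0.
  congr GFData; apply: fpsP => j; case: (sub0 j).
    by rewrite coefsD coefsN => dA _; apply: subr0_eq.
  rewrite !coefsD !coefsN opprK => _; rewrite addrC => dR.
  by apply: esym; apply: subr0_eq.
elim/ltn_ind: j => -[_|j IHj].
  by rewrite !coefsD !coefsN A0 A'0 R0 R'0 !subrr.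
have lowA i : (i < j.+1)%N -> coefs (A - A') i = 0 by move/IHj=> [].
have lowR i : (i < j.+1)%N -> coefs (- R - - R') i = 0 by move/IHj=> [].
have rel k : k.+1%:R * (a k * coefs (A - A') j.+1
    + a k.+1 * coefs (- R - - R') j.+1) = 0.
  have /eqP := diag k j.+1; rewrite diag' eq_sym -subr_eq0 -sumrB.
  under eq_bigr => i _.
    rewrite -mulrBr -mulrBr coefs_sub_expM_low //; over.
  rewrite !big_ord_recl /= big1 => [/eqP <-|i _]; last first.
    by rewrite !mul0r addr0 !mulr0.
  by rewrite !(addn0, addn1) binn binSn; ring.
have nz n : (n.+1%:R : K) != 0 by rewrite pnatr_eq0.
move: (coefs (A - A') _) (coefs (- R - _) _) rel => dA dR rel.
have /eqP := rel 0%N; rewrite mulf_eq0 (negPf (nz 0)) /= => /eqP rel0.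
have /eqP := rel 1%N; rewrite mulf_eq0 (negPf (nz 1)) /= => /eqP rel1.
have nz_d : a 0 * a 2 - a 1 ^+ 2 != 0 by rewrite subr_eq0.
split; apply: (mulfI nz_d); rewrite mulr0.
  transitivity (a 2 * (a 0 * dA + a 1 * dR) - a 1 * (a 1 * dA + a 2 * dR)).
    by ring.
  by rewrite rel0 rel1 !mulr0 subrr.
transitivity (a 0 * (a 1 * dA + a 2 * dR) - a 1 * (a 0 * dA + a 1 * dR)).
  by ring.
by rewrite rel0 rel1 !mulr0 subrr.
Qed.

(** * Coefficients of low order *)

Lemma coefsM1 (K : comNzRingType) (f g : fps K) :
  coefs (f * g) 1 = coefs f 0 * coefs g 1 + coefs f 1 * coefs g 0.
Proof. by rewrite coefsM !big_ord_recl big_ord0 /= addr0. Qed.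

Lemma coefsM2 (K : comNzRingType) (f g : fps K) :
  coefs (f * g) 2 = coefs f 0 * coefs g 2 + coefs f 1 * coefs g 1
    + coefs f 2 * coefs g 0.
Proof. by rewrite coefsM !big_ord_recl big_ord0 /= addr0 !addrA. Qed.

Lemma coefsM3 (K : comNzRingType) (f g : fps K) :
  coefs (f * g) 3 = coefs f 0 * coefs g 3 + coefs f 1 * coefs g 2
    + coefs f 2 * coefs g 1 + coefs f 3 * coefs g 0.
Proof. by rewrite coefsM !big_ord_recl big_ord0 /= addr0 !addrA. Qed.

Lemma coefs_exp1 (K : comNzRingType) (f : fps K) n : coefs f 0 = 1 ->
  coefs (f ^+ n) 1 = n%:R * coefs f 1.
Proof.
move=> f0; elim: n => [|n IHn]; first by rewrite mul0r.
by rewrite exprS coefsM1 IHn coefs_exp0 f0 expr1n mulrS; ring.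
Qed.

Lemma coefs_exp2 (K : numFieldType) (f : fps K) n : coefs f 0 = 1 ->
  coefs (f ^+ n) 2 =
  n%:R * coefs f 2 + n%:R * (n%:R - 1) / 2%:R * coefs f 1 ^+ 2.
Proof.
move=> f0; elim: n => [|n IHn]; first by rewrite !mul0r addr0.
by rewrite exprS coefsM2 IHn coefs_exp0 coefs_exp1 // f0 expr1n mulrS; field.
Qed.

Lemma poly_eq0_nat (K : numFieldType) (p : {poly K}) :
  (forall k : nat, p.[k%:R] = 0) -> p = 0.
Proof.
move=> p0; apply/eqP; apply: contraT => nz_p.
have := max_poly_roots nz_p (_ : all (root p) [seq k%:R | k <- iota 0 (size p)]).
rewrite size_map size_iota ltnn => -> //.
  by apply/allP => _ /mapP[k _ ->]; apply/rootP.
by rewrite map_inj_uniq ?iota_uniq //; apply: (mulrIn (oner_neq0 K)).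
Qed.

(** * Necessary conditions for the Bessel polynomials *)

(* Simplification would otherwise unfold the product of series to a sum. *)
#[local] Arguments coefs : simpl never.

Section BesselConditions.
Variables (K : numFieldType) (alpha : K) (a : nat -> K) (A S : fps K).
Hypothesis halpha : forall k : nat, alpha <> - k%:R.
Hypothesis nz_a : forall n, a n != 0.
Hypothesis A0 : coefs A 0 = 1.
Hypothesis S0 : coefs S 0 = 0.
Hypothesis diag : forall k j, a (k + j)%N * (monic_bessel alpha (k + j)%N)`_k =
    \sum_(i < j.+1) a (k + i)%N *
      ('C(k + i, k)%:R * coefs (A ^+ k.+1 * S ^+ i) j).

Let D (k : nat) : K := k%:R + k%:R + alpha.

Let nz_D k i : D k + i%:R != 0.
Proof.
apply/eqP => eq0; apply: (halpha (k := (k + k + i)%N)); apply/eqP.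
by rewrite -subr_eq0 opprK !natrD -eq0 /D; apply/eqP; ring.
Qed.

Lemma coef_monic_bessel_diag k j :
  (monic_bessel alpha (k + j)%N)`_k =
  2%:R ^+ j * 'C(k + j, k)%:R / poch (D k + j%:R - 1) j.
Proof.
have := poch_bessel_neq0 (k + j)%N halpha.
rewrite coef_monic_bessel leq_addr addKn pochD mulf_eq0 negb_or.
case/andP=> nz1 nz2.
have -> : D k + j%:R - 1 = (k + j)%:R + alpha - 1 + k%:R.
  by rewrite /D natrD; ring.
by move: nz1 nz2; move: (poch _ _) (poch _ _) => x y nz1 nz2; field; apply/andP.
Qed.

(** This is E(k,1) multiplied by (2 k + alpha) / (k + 1). *)
Lemma gf_bessel_rel1 k :
  a k * coefs A 1 * D k = a k.+1 * (2%:R - coefs S 1 * D k).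
Proof.
have := diag k 1; rewrite coef_monic_bessel_diag.
rewrite /poch !big_ord_recl !big_ord0 /= /bump /= add1n.
rewrite expr0 !expr1 !mulr1 !addr0 !addn0 !addn1 binn binSn.
rewrite coefsM1 !coefs_exp1 // coefs_exp0 A0 S0 expr1n addrK => rel.
have := nz_D k 0; rewrite addr0 => nzD.
have nzk : k.+1%:R != 0 :> K by rewrite pnatr_eq0.
apply: (mulfI nzk); apply/eqP; rewrite -subr_eq0; apply/eqP.
transitivity (D k * ((a k * (1 * (k.+1%:R * coefs A 1)) +
  a k.+1 * (k.+1%:R * (1 * coefs S 1 + k.+1%:R * coefs A 1 * 0)))
   - a k.+1 * (2%:R * k.+1%:R / D k))); first by field.
by rewrite rel subrr mulr0.
Qed.

(** This is E(k,2) divided by k + 1. *)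
Lemma gf_bessel_rel2 k :
  a k.+2 * (2%:R * k.+2%:R) / ((D k + 1) * (D k + 2%:R)) =
  a k * (coefs A 2 + k%:R / 2%:R * coefs A 1 ^+ 2) +
  a k.+1 * (coefs S 2 + k.+1%:R * coefs A 1 * coefs S 1) +
  a k.+2 * (k.+2%:R / 2%:R * coefs S 1 ^+ 2).
Proof.
have := diag k 2; rewrite coef_monic_bessel_diag.
rewrite /poch !big_ord_recl !big_ord0 /= /bump /= !add1n.
rewrite expr0 expr1 !mulr1 !addr0 !addn0 !addn1 !addn2 binn binSn.
rewrite coefs_exp2 // !coefsM2 coefs_exp1 // !coefs_exp0 A0 S0 expr1n.
rewrite expr2 coefsM1 S0.
have -> : 'C(k.+2, k)%:R = k.+1%:R * k.+2%:R / 2%:R :> K.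
  have -> : 'C(k.+2, k) = 'C(k.+2, 2) by rewrite -[RHS]bin_sub // subn2.
  have := mul_bin_diag k.+2 1; rewrite bin1 /= => /(congr1 (fun n => n%:R : K)).
  by rewrite !natrM => bin2; apply: (mulfI (_ : 2%:R != 0 :> K));
     rewrite ?pnatr_eq0 // -bin2; field.
move=> rel.
have nzk : k.+1%:R != 0 :> K by rewrite pnatr_eq0.
have nz1 := nz_D k 1; have nz2 := nz_D k 2.
apply: (mulfI nzk); move: rel nzk.
have -> : D k + 2%:R - 1 = D k + 1 by ring.
rewrite (_ : D k + 1 + 1 = D k + 2%:R); last by ring.
have -> : k.+2%:R = k%:R + 2%:R :> K by rewrite -natrD addn2.
have -> : k.+1%:R = k%:R + 1 :> K by rewrite mulrSr.
move=> rel nzk.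
transitivity (a k.+2 * (2%:R ^+ 2 * ((k%:R + 1) * (k%:R + 2%:R) / 2%:R)
    / ((D k + 1) * (D k + 2%:R)))); first by field; apply/andP.
by rewrite rel; field.
Qed.

(** If A_1 were 0, then S_1 (2k + alpha) = 2 would hold for k = 0 and k = 1;
    the difference gives S_1 = 0, which is absurd. *)
Lemma gf_bessel_A1_neq0 : coefs A 1 != 0.
Proof.
apply/eqP => A1; have := gf_bessel_rel1 1; have := gf_bessel_rel1 0.
rewrite A1 !mulr0 !mul0r.
move=> /esym/eqP; rewrite mulf_eq0 (negPf (nz_a _)) /= => /eqP r0.
move=> /esym/eqP; rewrite mulf_eq0 (negPf (nz_a _)) /= => /eqP r1.
have eq_rD : coefs S 1 * (D 1 - D 0) = 0.
  by rewrite -(subrr 0) -{1}r0 -r1; ring.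
have /eqP : coefs S 1 * 2%:R = 0 by rewrite -[RHS]eq_rD /D; ring.
rewrite mulf_eq0 (negPf (_ : 2%:R != 0)) ?pnatr_eq0 // orbF => /eqP S1.
by move: r0; rewrite S1 mul0r subr0 => /eqP; rewrite pnatr_eq0.
Qed.

(** The relation [gf_bessel_rel2] divided by a_(k+2), with the ratios of the
    a_n taken from [gf_bessel_rel1], and multiplied by -d (d+1) (d+2). It is
    polynomial in k, so k may be replaced by any scalar x, in particular by
    the values at which d = 2 x + alpha is one of the former poles. *)
Lemma gf_bessel_poly_rel x (d := x + x + alpha) (s := coefs S 1)
    (q := coefs A 2 / coefs A 1 ^+ 2) (rho := coefs S 2 / coefs A 1) :
  (2%:R - s * d) * (2%:R - s * (d + 2%:R)) * (d + 1) * (q + x / 2%:R)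
  + (2%:R - s * (d + 2%:R)) * d * (d + 1) * (rho + (x + 1) * s)
  + (x + 2%:R) / 2%:R * s ^+ 2 * d * (d + 1) * (d + 2%:R)
  - 2%:R * (x + 2%:R) * d = 0.
Proof.
have nzA1 := gf_bessel_A1_neq0.
pose X : {poly K} := 'X; pose dX := X + X + alpha%:P.
pose Q := (2%:R%:P - s%:P * dX) * (2%:R%:P - s%:P * (dX + 2%:R%:P))
    * (dX + 1%:P) * (q%:P + X * (2%:R^-1)%:P)
  + (2%:R%:P - s%:P * (dX + 2%:R%:P)) * dX * (dX + 1%:P)
    * (rho%:P + (X + 1%:P) * s%:P)
  + (X + 2%:R%:P) * (2%:R^-1)%:P * (s ^+ 2)%:P * dX * (dX + 1%:P)
    * (dX + 2%:R%:P)
  - 2%:R%:P * (X + 2%:R%:P) * dX.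
suff Q0 : Q = 0.
  by have := horner0 x; rewrite -Q0 /Q /dX /X !(hornerD, hornerM, hornerN, hornerX, hornerC).
apply: poly_eq0_nat => {x d} k; rewrite /Q /dX /X !(hornerD, hornerM, hornerN, hornerX, hornerC) -/(D k).
have := gf_bessel_rel2 k.
have := gf_bessel_rel1 k; have := gf_bessel_rel1 k.+1.
have nz1 := nz_D k 1; have nz2 := nz_D k 2.
have nz0 : D k != 0 by have := nz_D k 0; rewrite addr0.
have -> : D k.+1 = D k + 2%:R by rewrite /D !mulrSr; ring.
have -> : k.+2%:R = k%:R + 2%:R :> K by rewrite -natrD addn2.
have -> : k.+1%:R = k%:R + 1 :> K by rewrite mulrSr.
rewrite -/s; move=> rel1 rel0 rel2.
have nza := nz_a k.+2.
have a1E : a k.+1 = a k.+2 * (2%:R - s * (D k + 2%:R)) / (coefs A 1 * (D k + 2%:R)).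
  by rewrite -rel1; field; rewrite nzA1 nz2.
have a0E : a k = a k.+1 * (2%:R - s * D k) / (coefs A 1 * D k).
  by rewrite -rel0; field; rewrite nzA1 nz0.
move/eqP: rel2; rewrite -subr_eq0 a0E a1E => /eqP rel2.
apply: (mulfI nza).
rewrite mulr0 -(mulr0 (- (D k * (D k + 1) * (D k + 2%:R)))) -rel2 /q /rho.
by field; rewrite nzA1 nz1 nz2 nz0.
Qed.

(** At d = -1 only the last term of the polynomial relation survives. *)
Lemma gf_bessel_alpha : alpha = 3%:R.
Proof.
have /= := gf_bessel_poly_rel (- (alpha + 1) / 2%:R).
rewrite (_ : _ + _ + alpha = - 1); last by field.
move=> rel; have /eqP : 3%:R - alpha = 0 by rewrite -[RHS]rel; field; exact: gf_bessel_A1_neq0.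
by rewrite subr_eq0 => /eqP.
Qed.

(** With alpha = 3 the polynomial relation vanishes at d = -1 and has degree at
    most 3 in d, so three more values exhaust it; d = 0 and d = -2 are the
    remaining poles, and d = 1 is chosen for its small numbers. *)
Lemma gf_bessel_dichotomy (s := coefs S 1) (q := coefs A 2 / coefs A 1 ^+ 2)
    (rho := coefs S 2 / coefs A 1) :
  s = 0 \/ [/\ s = 1, q = 2%:R^-1 & rho = 2%:R^-1].
Proof.
have rel x := gf_bessel_poly_rel x; cbv zeta in rel; rewrite gf_bessel_alpha -/s -/q -/rho in rel.
(* The points d = 0, d = -2 and d = 1, where x = (d - 3) / 2. *)
have rel0 : (1 - s) * (q - 3%:R / 4%:R) = 0.
  by apply: (mulfI (_ : 4%:R != 0)); rewrite ?pnatr_eq0 // mulr0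
     -(rel (- 3%:R / 2%:R)); field.
have relN2 : (1 + s) * (q - 5%:R / 4%:R) - rho + 3%:R / 2%:R * s + 2%:R^-1 = 0.
  by apply: (mulfI (_ : - 4%:R != 0)); rewrite ?oppr_eq0 ?pnatr_eq0 // mulr0
     -(rel (- 5%:R / 2%:R)); field.
have rel1 : (2%:R - s) * (2%:R - 3%:R * s) * (q - 2%:R^-1)
    + (2%:R - 3%:R * s) * rho + 3%:R / 2%:R * s ^+ 2 - 1 = 0.
  by apply: (mulfI (_ : 2%:R != 0)); rewrite ?pnatr_eq0 // mulr0
     -(rel (- 1)); field.
move/eqP: rel0; rewrite mulf_eq0 !subr_eq0 => /orP[/eqP s1 | /eqP q34].
  right; have rhoE : rho = 2%:R * q - 2%:R^-1.
    by apply/eqP; rewrite -subr_eq0 -oppr_eq0 -relN2 -s1; apply/eqP; field.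
  have qE : q = 2%:R^-1.
    apply/eqP; rewrite -subr_eq0; apply/eqP.
    apply: (mulfI (_ : - 3%:R != 0)); rewrite ?oppr_eq0 ?pnatr_eq0 // mulr0.
    by rewrite -rel1 -s1 rhoE; field.
  by split=> //; rewrite rhoE qE; field.
left; have rhoE : rho = s.
  by apply/eqP; rewrite -subr_eq0 -oppr_eq0 -relN2 q34; apply/eqP; field.
have : s ^+ 2 = 0.
  apply: (mulfI (_ : - 3%:R / 4%:R != 0)); first by rewrite mulf_neq0 ?invr_eq0 ?oppr_eq0 ?pnatr_eq0.
  by rewrite mulr0 -rel1 q34 rhoE; field.
by move=> /eqP; rewrite expf_eq0 => /eqP.
Qed.

Hypothesis a0 : a 0 = 1.

(** In the exceptional case the ratios give a_n = (2n+1) (-A_1)^n. The equations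
    E(0,3), E(1,3), E(2,3), weighted by A_1^2, A_1 and 1/3, add up to one in
    which A_3 and S_3 cancel. What remains is 8/945 A_1^5 = 0: p_(k+3,k) has a
    pole at k = -5/2 which the right-hand side, polynomial in k up to the
    factor (-A_1)^k, cannot match. *)
Lemma gf_bessel_S1 : coefs S 1 = 0.
Proof.
case: gf_bessel_dichotomy => // -[S1 A2 S2].
have nzA1 := gf_bessel_A1_neq0.
have {}A2 : coefs A 2 = coefs A 1 ^+ 2 / 2%:R.
  by rewrite -[LHS](mulfVK (expf_neq0 2 nzA1)) A2 mulrC.
have {}S2 : coefs S 2 = coefs A 1 / 2%:R.
  by rewrite -[LHS](mulfVK nzA1) S2 mulrC.
have aS k : a k.+1 = - (k.*2.+3)%:R / (k.*2.+1)%:R * coefs A 1 * a k.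
  have nz1 : k.*2.+1%:R != 0 :> K by rewrite pnatr_eq0.
  have := gf_bessel_rel1 k; rewrite S1 /D gf_bessel_alpha.
  have -> : k%:R + k%:R + 3%:R = k.*2.+3%:R :> K by rewrite -!natrD addnn addn3.
  have -> : k.*2.+3%:R = k.*2.+1%:R + 2%:R :> K by rewrite -natrD addn2.
  move: (k.*2.+1%:R) nz1 => y nz1 /esym rel1.
  apply: (mulfI nz1); apply: oppr_inj.
  transitivity (a k.+1 * (2%:R - 1 * (y + 2%:R))); first by ring.
  by rewrite rel1; field.
have a1 : a 1 = - 3%:R * coefs A 1 by rewrite aS a0 ?(doubleS, double0); field.
have a2 : a 2 = 5%:R * coefs A 1 ^+ 2 by rewrite aS a1 ?(doubleS, double0); field.
have a3 : a 3 = - 7%:R * coefs A 1 ^+ 3 by rewrite aS a2 ?(doubleS, double0); field.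
have a4 : a 4 = 9%:R * coefs A 1 ^+ 4 by rewrite aS a3 ?(doubleS, double0); field.
have a5 : a 5 = - 11%:R * coefs A 1 ^+ 5 by rewrite aS a4 ?(doubleS, double0); field.
(* The equation E(k,3) with S_1 = 1. *)
have rel k : a k.+3 * (8%:R * 'C(k.+3, k)%:R /
      ((D k + 2%:R) * (D k + 3%:R) * (D k + 4%:R))) =
    a k * coefs (A ^+ k.+1) 3 +
    a k.+1 * (k.+1%:R * (coefs S 3 + coefs (A ^+ k.+1) 1 * coefs S 2
       + coefs (A ^+ k.+1) 2)) +
    a k.+2 * ('C(k.+2, k)%:R * (2%:R * coefs S 2 + coefs (A ^+ k.+1) 1)) +
    a k.+3 * 'C(k.+3, k)%:R.
  have := diag k 3; rewrite coef_monic_bessel_diag.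
  rewrite /poch !big_ord_recl !big_ord0 /= /bump /= !add1n.
  rewrite !addn0 !addn1 !addn2 !addn3 binn binSn expr0 mulr1 expr1.
  have -> : S ^+ 3 = S * (S * S) by rewrite !exprS expr0 mulr1.
  rewrite [S ^+ 2]expr2.
  rewrite !(coefsM3, coefsM2, coefsM1, coefsM0) !coefs_exp0 A0 S0 S1 expr1n.
  have -> : D k + 3%:R - 1 + 0 = D k + 2%:R by ring.
  have -> : D k + 3%:R - 1 + 1 = D k + 3%:R by ring.
  have -> : D k + 3%:R - 1 + 2%:R = D k + 4%:R by ring.
  rewrite !coefs1 /= => rel.
  transitivity (a k.+3 * (2%:R ^+ 3 * 'C(k.+3, k)%:R /
     ((D k + 2%:R) * ((D k + 3%:R) * (D k + 4%:R))))).
    by field; rewrite !nz_D.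
  by rewrite rel; ring.
have D0 : D 0 = 3%:R by rewrite /D gf_bessel_alpha; ring.
have D1 : D 1 = 5%:R by rewrite /D gf_bessel_alpha; ring.
have D2 : D 2 = 7%:R by rewrite /D gf_bessel_alpha; ring.
have := rel 0%N; have := rel 1%N; have := rel 2%N.
rewrite D0 D1 D2 a0 a1 a2 a3 a4 a5 !coefs_exp1 // !coefs_exp2 // !exprS !expr0.
rewrite !mulr1 !(coefsM3, coefsM2, coefsM1, coefsM0) !A0 A2 S2.
have -> : 'C(5, 2) = 10%N by [].
have -> : 'C(4, 2) = 6%N by [].
have -> : 'C(4, 1) = 4%N by [].
have -> : 'C(3, 1) = 3%N by [].
rewrite !bin0.
move=> /eqP; rewrite -subr_eq0 => /eqP rel2.
move=> /eqP; rewrite -subr_eq0 => /eqP rel1.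
move=> /eqP; rewrite -subr_eq0 => /eqP rel0.
suff comb x0 x1 x2 : x0 = 0 -> x1 = 0 -> x2 = 0 ->
    8%:R / 945%:R * coefs A 1 ^+ 5 =
    coefs A 1 ^+ 2 * x0 + coefs A 1 * x1 + x2 / 3%:R -> coefs S 1 = 0.
  by apply: (comb _ _ _ rel0 rel1 rel2); field.
move=> -> -> ->; rewrite !mulr0 mul0r !addr0 => /eqP.
by rewrite mulf_eq0 expf_eq0 (negPf nzA1) orbF mulf_eq0 invr_eq0 !pnatr_eq0.
Qed.

Lemma gf_bessel_coefE n :
  a n = (coefs A 1 / 2%:R) ^+ n * (2%:R ^+ n * poch (3%:R / 2%:R) n).
Proof.
elim: n => [|n IHn]; first by rewrite a0 /poch big_ord0 !mulr1.
have := gf_bessel_rel1 n; rewrite gf_bessel_S1 mul0r subr0 IHn => rel1.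
apply: (mulIf (_ : 2%:R != 0)); first by rewrite pnatr_eq0.
by rewrite -rel1 /D gf_bessel_alpha pochS !exprS; field.
Qed.

End BesselConditions.

Theorem theorem3p5 (R : realType) (alpha : R[i])
    (halpha : forall k : nat, alpha <> - k%:R) :
  [/\ Fps (fun n => (poch (3%:R / 2%:R) n * 2%:R ^+ n)
                      *: monic_bessel (3%:R : R[i]) n)
      = (1 - fpsX {poly R[i]}) ^- 2 *
          fps_comp (fps_polyC (hyp2F0 (3%:R / 2%:R) 1))
            (2%:R * fpsC 'X * fpsX {poly R[i]} / (1 - fpsX {poly R[i]}) ^+ 2),
      is_generating_function (monic_bessel (3%:R : R[i])) (bessel_gf R[i])
    & forall G : gf_data R[i],
        is_generating_function (monic_bessel alpha) G ->
        alpha = 3%:R /\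
        exists c : R[i], c <> 0 /\ G = gf_rescale c (bessel_gf R[i])].
Proof.
split; [exact: monic_bessel3_series | exact: monic_bessel3_gf |].
move=> [a A S F] gfG; have [_ [nz_a a0] defF [A0 S0] gfE] := gfG.
have NS0 : coefs (- S) 0 = 0 by rewrite coefsN S0 oppr0.
rewrite defF in gfE; have diag := gf_diag S0 gfE.
have alpha3 := gf_bessel_alpha halpha nz_a A0 NS0 diag.
have aE := gf_bessel_coefE halpha nz_a A0 NS0 diag a0.
have nz_c : coefs A 1 / 2%:R != 0.
  have nzA1 := gf_bessel_A1_neq0 halpha nz_a A0 NS0 diag.
  by rewrite mulf_neq0 // invr_eq0 pnatr_eq0.
split=> //; exists (coefs A 1 / 2%:R); split; first exact/eqP.
move: (coefs A 1 / 2%:R) nz_c aE => c nz_c aE.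
apply: gf_unique gfG _ _ _.
- by rewrite alpha3; apply: is_gf_rescale nz_c (monic_bessel3_gf _).
- exact: funext.
rewrite /= !aE /poch !big_ord_recl !big_ord0 /= /bump /= -subr_eq0.
rewrite [X in X != 0](_ : _ = (c * 2%:R) ^+ 2 * (3%:R / 2%:R)); last by field.
by rewrite !mulf_neq0 ?invr_eq0 ?pnatr_eq0 // expf_neq0 // mulf_neq0 ?pnatr_eq0.
Qed.
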